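(* Let $\{(N_k,B_k)\}_{k=1}^\infty$ be a sequence where, for every $k\ge1$, $N_k\ge2$ is an integer and $B_k$ is a finite set with $0\in B_k\subseteq\{0,1,2,\dots\}$ and $\#B_k\le N_k$. Suppose that the sequence satisfies the remainder bounded condition $$\sum_{k=1}^{\infty}\frac{\#B_{k,2}}{\#B_k}<\infty,\qquad B_{k,1}=B_k\cap\{0,1,\dots,N_k-1\},\quad B_{k,2}=B_k\setminus B_{k,1},$$ and that $$\sup_{k\ge1}\frac{\log\max B_k}{\log N_k}<\infty.$$ Then the infinite convolution $\mu(\boldsymbol{\omega})$ exists for every $\boldsymbol{\omega}\in\Omega$. Moreover, $\Phi=\{\mu(\boldsymbol{\omega}):\boldsymbol{\omega}\in\Omega\}$ is tight.
   Context: $\Omega=\mathbb{N}^{\mathbb{N}}$, with index set $\mathbb{N}=\{1,2,3,\dots\}$, is the set of infinite sequences $\boldsymbol{\omega}=\omega_1\omega_2\cdots$ of positive integers. For a finite nonempty $A\subset\mathbb{R}$, $\delta_A=\frac{1}{\#A}\sum_{a\in A}\delta_a$ with $\delta_a$ the Dirac measure at $a$; $cA=\{ca:a\in A\}$; $*$ is convolution of measures. For $\boldsymbol{\omega}\in\Omega$, the infinite convolution $$\mu(\boldsymbol{\omega})=\delta_{N_{\omega_1}^{-1}B_{\omega_1}}*\delta_{(N_{\omega_1}N_{\omega_2})^{-1}B_{\omega_2}}*\cdots$$ is said to exist if the finite convolutions $\delta_{N_{\omega_1}^{-1}B_{\omega_1}}*\cdots*\delta_{(N_{\omega_1}\cdots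 N_{\omega_k})^{-1}B_{\omega_k}}$ converge weakly, as $k\to\infty$, to a Borel probability measure on $\mathbb{R}$; $\mu(\boldsymbol{\omega})$ denotes this limit. Convention: $\log 0=-\infty$. A set $\Psi$ of Borel probability measures on $\mathbb{R}$ is tight if for each $\epsilon>0$ there is a compact $K\subseteq\mathbb{R}$ with $\inf_{\nu\in\Psi}\nu(K)>1-\epsilon$. *)

(* Defs.v *)
From mathcomp Require Import all_boot all_order all_algebra finmap.
From mathcomp Require Import all_classical all_reals all_analysis.
Set Implicit Arguments.
Unset Strict Implicit.
Unset Printing Implicit Defensive.
Import Order.TTheory GRing.Theory Num.Theory.
Import numFieldNormedType.Exports.

Local Open Scope classical_set_scope.
Local Open Scope ring_scope.
Local Open Scope ereal_scope.
Local Open Scope fset_scope.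

(* Borel measures on the line are handled as set functions on
   [measurableTypeR R]; only their values on Borel sets matter. *)

Definition delta (R : realType) (A : {fset R}) :
    set (measurableTypeR R) -> \bar R :=
  fun U => ((#|` A|%:R)^-1)%:E * \sum_(a <- A) dirac (a : measurableTypeR R) U.

Definition scale_set (R : realType) (c : R) (B : {fset nat}) : {fset R} :=
  [fset (c * b%:R)%R | b in B].

Definition convolution (R : realType)
    (mu nu : set (measurableTypeR R) -> \bar R) :
    set (measurableTypeR R) -> \bar R :=
  pushforward (mu \x nu)
    (fun z : measurableTypeR R * measurableTypeR R => (z.1 + z.2)%R).

(* Sequences are indexed from 0: [N k], [B k] and [w k] stand for the
   mathematical N_(k+1), B_(k+1) and omega_(k+1), a letter [j : nat] of [w]
   standing for the positive integer j + 1. *)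

Definition convolution_factor (R : realType) (N : nat -> nat) (B : nat -> {fset nat})
    (w : nat -> nat) (n : nat) : set (measurableTypeR R) -> \bar R :=
  delta (scale_set (\prod_(i < n.+1) (N (w i))%:R)^-1%R (B (w n))).

(* The convolution of the first [n.+1] factors. *)
Fixpoint finite_convolution (R : realType) (N : nat -> nat)
    (B : nat -> {fset nat}) (w : nat -> nat) (n : nat) :
    set (measurableTypeR R) -> \bar R :=
  if n is m.+1
  then convolution (finite_convolution N B w m) (convolution_factor N B w m.+1)
  else convolution_factor N B w 0.

Definition converges_weakly (R : realType)
    (mu : nat -> set (measurableTypeR R) -> \bar R)
    (nu : probability (measurableTypeR R) R) : Prop :=
  forall f : R -> R, continuous f -> bounded_fun f ->
    \int[mu n]_x (f x)%:E @[n --> \oo] --> \int[nu]_x (f x)%:E.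

(* [nu] is mu(w); such a [nu] is unique, as weak limits are. *)
Definition is_infinite_convolution (R : realType) (N : nat -> nat)
    (B : nat -> {fset nat}) (w : nat -> nat)
    (nu : probability (measurableTypeR R) R) : Prop :=
  converges_weakly (finite_convolution N B w) nu.

Definition tight (R : realType) (Psi : set (probability (measurableTypeR R) R)) :
    Prop :=
  forall e : R, (0 < e)%R -> exists2 K : set R, compact K &
    (1 - e)%:E < ereal_inf [set nu K | nu in Psi].

Definition low_part (n : nat) (A : {fset nat}) : {fset nat} :=
  [fset b in A | (b < n)%N].

Definition high_part (n : nat) (A : {fset nat}) : {fset nat} :=
  A `\` low_part n A.

Definition remainder_bounded (R : realType) (N : nat -> nat)
    (B : nat -> {fset nat}) : Prop :=
  \sum_(0 <= k <oo) (#|` high_part (N k) (B k)|%:R / #|` B k|%:R : R)%:E < +oo.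

(* [lne] is extended-real valued with [lne 0 = -oo], so that the quotient is
   [-oo] when [B k] is {0}. *)
Definition log_ratio (R : realType) (N : nat -> nat) (B : nat -> {fset nat})
    (k : nat) : \bar R :=
  lne ((\max_(b <- B k) b)%N%:R)%:E / lne ((N k)%:R)%:E.

(* Main.v *)
From HB Require Import structures.
Require Import Defs.
From mathcomp Require Import all_boot all_order all_algebra finmap.
From mathcomp Require Import all_classical all_reals all_analysis.
From mathcomp Require Import measurable_realfun.
From mathcomp Require Import ring lra zify.
Import Order.TTheory GRing.Theory Num.Theory.
Import numFieldNormedType.Exports.

Set Implicit Arguments.
Unset Strict Implicit.
Unset Printing Implicit Defensive.

Local Open Scope classical_set_scope.
Local Open Scope ring_scope.

(** Let [S_n] be a random variable with law [finite_convolution N B w n]: it is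
    the sum over [i <= n] of independent terms
    [X_i / (N_(w 0) * ... * N_(w i))] with [X_i] uniform on [B_(w i)].

    The terms are nonnegative, so [S_n] increases with [n] and its distribution
    function [F_n] decreases with [n] at every point
    ([finite_convolution_cdf_decr]).  The infimum [F] of the [F_n] is again
    nondecreasing and right-continuous, and it vanishes on the negative
    half-line.  It can fail to be a distribution function only by losing mass
    at [+oo].  If it loses none, it is the distribution function of a
    Lebesgue-Stieltjes probability, and pointwise convergence of distribution
    functions gives weak convergence
    ([decreasing_cdf_converges_weakly], [converges_weakly_cdf]).

    Both conclusions thus follow from a bound on
    [P (S_n > C)] that is uniform in [n] and in [w] ([uniform_tail]).  The
    growth condition provides an integer [M] with [b <= N_k ^ M] for all [b] in
    [B_k] ([digit_le_exp]).  Given a threshold [K], the term of index [n] is at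
    most [D / 2 ^ n], with [D] independent of [w] and [n], in three cases
    ([digit_bound]): the digit is smaller than [N_(w n)]; the letter [w n] is
    one of the finitely many letters below [K]; or [w n] has already occurred
    [M] times before, since then the denominator contains [N_(w n) ^ M] times
    [n - M] further factors that are at least 2.  Outside these cases the
    letter is at least [K], is visited for one of its first [M] times, and the
    digit is high, which has probability [#B_(k,2) / #B_k] for the letter [k].
    A letter has only [M] such visits, so the probabilities of all exceptional
    events add up to at most [M] times the tail from [K] on of the convergent
    series of the [#B_(k,2) / #B_k], whatever the sequence [w] is
    ([sum_visits_high_ratio]).  With [K] large the exceptional events are
    negligible, and outside them [S_n <= 2 D]. *)

(** * Convolutions of probability measures *)

Section convolution_measure.
Context (R : realType) (P Q : probability (measurableTypeR R) R).
Local Notation T := (measurableTypeR R).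

Let add (z : T * T) : T := z.1 + z.2.

Let measurable_add : measurable_fun setT add.
Proof. exact: measurable_funD. Qed.

HB.instance Definition _ := isMeasurableFun.Build _ _ _ _ add measurable_add.

Lemma convolution_probability :
  exists PQ : probability T R, convolution P Q = PQ :> (set T -> \bar R).
Proof. by exists (distribution (P \x Q)%E add). Qed.

(** A union bound: the event that the sum lies in [U] is covered by one event on
    each summand. *)
Lemma convolution_le (U A B : set T) :
  measurable U -> measurable A -> measurable B ->
  (forall x y, U (x + y) -> A x \/ B y) ->
  (convolution P Q U <= P A + Q B)%E.
Proof.
move=> mU mA mB UAB.
have mAT : measurable (A `*` [set: T]) by exact: measurableX.
have mTB : measurable ([set: T] `*` B) by exact: measurableX.
have -> : P A = (P \x Q)%E (A `*` setT).
  by rewrite product_measure1E//= (@probability_setT _ _ _ Q) mule1.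
have -> : Q B = (P \x Q)%E (setT `*` B).
  by rewrite product_measure1E//= (@probability_setT _ _ _ P) mul1e.
rewrite (@le_trans _ _ ((P \x Q)%E (A `*` setT `|` setT `*` B)))//; last first.
  exact: measureU2.
rewrite /convolution /pushforward -[X in (_ X <= _)%E]/(add @^-1` U).
apply: (@le_measure _ _ _ (P \x Q)%E); rewrite ?inE.
- by rewrite -[X in measurable X]setTI; exact: measurable_add.
- exact: measurableU.
- by move=> [x y] /= /UAB[?|?]; [left|right].
Qed.

End convolution_measure.

(** * Weak convergence from distribution functions *)

Lemma measure_ocitv (R : realType) (P : probability (measurableTypeR R) R)
  (a b : R) : a <= b ->
  P `]a, b]%classic = (P `]-oo, b]%classic - P `]-oo, a]%classic)%E.
Proof.
move=> ab.
have -> : `]a, b]%classic = `]-oo, b] `\` `]-oo, a] :> set R.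
  by rewrite -[RHS]setCK setCD setCitvl setUC -[LHS]setCK setCitv.
rewrite measureD ?setIidr//.
  exact: subset_itvl.
by rewrite -ge0_fin_numE// fin_num_measure.
Qed.

Lemma continuous_bounded_integrable (R : realType)
   (P : probability (measurableTypeR R) R) (f : R -> R) :
  continuous f -> bounded_fun f -> P.-integrable setT (EFin \o f).
Proof.
move=> cf bf; apply: measurable_bounded_integrable => //.
  by rewrite -ge0_fin_numE// fin_num_measure.
exact: continuous_measurable_fun.
Qed.

Section step_functions.
Context (R : realType) (P : probability (measurableTypeR R) R) (f : R -> R).
Hypotheses (cf : continuous f) (bf : bounded_fun f).
Local Notation T := (measurableTypeR R).

Let intf (D : set T) : measurable D -> P.-integrable D (EFin \o f).
Proof.
move=> mD; apply: (@integrableS _ _ _ P setT) => //.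
exact: continuous_bounded_integrable.
Qed.

Lemma Rintegral_cst_close (D : set T) (r e : R) : measurable D ->
  (forall x, D x -> `|f x - r| <= e) ->
  `|\int[P]_(x in D) f x - r * fine (P D)| <= e * fine (P D).
Proof.
move=> mD fr.
have icst c : P.-integrable D (EFin \o (fun=> c)).
  apply: measurable_bounded_integrable => //.
    by rewrite -ge0_fin_numE// fin_num_measure.
  by exists `|c|; split => // M /ltW cM x _.
rewrite -!Rintegral_cst// -RintegralB//; [|exact: intf].
have ifr : P.-integrable D (EFin \o (fun x => f x - r)).
  have -> : EFin \o (fun x => f x - r) =
      ((EFin \o f) \- (EFin \o (fun=> r)))%E by [].
  by apply: integrableB => //; first [exact: intf|exact: icst].
apply: le_trans (le_normr_Rintegral _ _) _ => //.
apply: le_Rintegral => //.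
exact: integrable_norm.
Qed.

(** The cells are open on the left and closed on the right, so that their
    measures are differences of values of the distribution function. *)
Lemma Rintegral_step_close (a h e : R) (n : nat) : 0 < h ->
  (forall x y, x \in `[a, a + n%:R * h] -> `|x - y| <= h ->
    `|f x - f y| <= e) ->
  `|\int[P]_(x in `]a, (a + n%:R * h)]) f x -
    \sum_(i < n) f (a + i.+1%:R * h) *
       fine (P `]a + i%:R * h, a + i.+1%:R * h]%classic)|
  <= e * fine (P `]a, a + n%:R * h]%classic).
Proof.
move=> h0; elim: n => [|n ih] fe.
  rewrite big_ord0 mul0r addr0 set_itvoc0 Rintegral_set0.
  by rewrite (@measure0 _ _ _ P) mulr0 subr0 normr0.
have nn : a + n%:R * h <= a + n.+1%:R * h.
  by rewrite lerD2l ler_wpM2r ?ler_nat// ltW.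
have an : a <= a + n%:R * h by rewrite lerDl mulr_ge0// ltW.
have U : `]a, a + n.+1%:R * h]%classic =
    `]a, a + n%:R * h] `|` `]a + n%:R * h, a + n.+1%:R * h] :> set R.
  by rewrite -itv_bndbnd_setU ?bnd_simp.
have Dj : `]a, a + n%:R * h] `&` `]a + n%:R * h, a + n.+1%:R * h] = set0
    :> set R.
  apply/seteqP; split => // x [] /=; rewrite !in_itv/= => /andP[_ x1] /andP[x2 _].
  by move: (lt_le_trans x2 x1); rewrite ltxx.
have PU : fine (P `]a, a + n.+1%:R * h]%classic) =
    fine (P `]a, a + n%:R * h]%classic) +
    fine (P `]a + n%:R * h, a + n.+1%:R * h]%classic).
  by rewrite U measureU// fineD// fin_num_measure.
rewrite PU U Rintegral_setU//;
  [|exact/intf/measurableU|by apply/disj_setPS; rewrite Dj].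
rewrite big_ord_recr/= opprD addrACA mulrDr (le_trans (ler_normD _ _))//.
apply: lerD.
  by apply: ih => x y xa; apply: fe; apply: subset_itvl xa; rewrite bnd_simp.
apply: Rintegral_cst_close => // x /=; rewrite in_itv/= => /andP[x1 x2].
apply: fe.
  by rewrite in_itv/= x2 andbT (le_trans an)// ltW.
rewrite ler_norml; apply/andP; split.
  move: x1; rewrite -natr1; lra.
move: x2; rewrite -natr1; lra.
Qed.

End step_functions.

(** Heine's theorem.  The point [y] need not lie in the interval: nearness of
    [y] to a point of the compact interval is enough for the covering
    argument. *)
Lemma uniformly_continuous_itv (R : realType) (f : R -> R) (a b e : R) :
  continuous f -> 0 < e ->
  exists2 d : R, 0 < d & forall x y, x \in `[a, b] -> `|x - y| < d ->
    `|f x - f y| < e.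
Proof.
move=> cf e0.
have /compact_near_coveringP/(_ R (0 : R)^'+
    (fun d x => forall y, `|x - y| < d -> `|f x - f y| < e)) :=
  @segment_compact R a b.
case=> [x _|d /= d0 H].
  have e20 : 0 < e / 2 by rewrite divr_gt0.
  have /cvgrPdist_lt/(_ _ e20)[/= r r0 fr] := cf x.
  exists (ball x (r / 2), [set d | d < r / 2]) => /=; first split.
  - by apply: nbhsx_ballx; rewrite divr_gt0.
  - by apply: nbhs_right_lt; rewrite divr_gt0.
  move=> [x' d] /= [xx' dr] y x'y.
  have fx' : `|f x - f x'| < e / 2.
    by apply: fr => /=; rewrite (lt_trans xx')//; lra.
  have fy : `|f x - f y| < e / 2.
    apply: fr => /=; rewrite -(subrKA x') (le_lt_trans (ler_normD _ _))//.
    move: xx'; rewrite /ball/= => xx'; lra.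
  rewrite -(subrKA (f x)) (le_lt_trans (ler_normD _ _))// distrC; lra.
exists (d / 2); first by rewrite divr_gt0.
move=> x y xab xy; apply: (H (d / 2)) => //=; last first.
  by rewrite divr_gt0.
rewrite /ball_ /= sub0r normrN ger0_norm; lra.
Qed.

Lemma probability_itv_gt (R : realType) (P : probability (measurableTypeR R) R)
  (e : R) : 0 < e ->
  exists2 k : nat, (0 < k)%N & 1 - e < fine (P `](- k%:R), k%:R]%classic).
Proof.
move=> e0.
have : fine (P `](- n%:R), n%:R]%classic) @[n --> \oo] --> (1 : R).
  apply: fine_cvg.
  have <- : P (\bigcup_n `](- n%:R), n%:R]%classic) = 1%E.
    by rewrite bigcup_itvT; exact: (@probability_setT _ _ _ P).
  apply: nondecreasing_cvg_mu => //; first exact: bigcup_measurable.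
  by move=> *; apply/subsetPset/subset_itv; rewrite leBSide/= ?lerN2 ler_nat.
move/cvgrPdist_lt => /(_ _ e0)[k _ /(_ k.+1 (leqnSn k))/=].
rewrite ltr_distl => /andP[_].
by exists k.+1 => //; lra.
Unshelve. all: by end_near. Qed.

(** Half of the Helly-Bray theorem, for distribution functions that converge
    everywhere.  An interval that carries most of the mass of [nu] carries most
    of the mass of [mu n] for large [n].  On it [f] is uniformly close to a step function, whose integral is a finite
    combination of measures of cells. *)
Lemma converges_weakly_cdf (R : realType)
    (mu : nat -> probability (measurableTypeR R) R)
    (nu : probability (measurableTypeR R) R) :
  (forall x : R,
    mu n `]-oo, x]%classic @[n --> \oo] --> nu `]-oo, x]%classic) ->
  converges_weakly (fun n => mu n : set (measurableTypeR R) -> \bar R) nu.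
Proof.
move=> cdf f cf bf.
have RintE (P : probability (measurableTypeR R) R) :
    (\int[P]_x (f x)%:E = (\int[P]_x f x)%:E)%E.
  rewrite /Rintegral fineK//; apply: integrable_fin_num => //.
  exact: continuous_bounded_integrable.
under eq_fun do rewrite RintE.
rewrite RintE; apply: cvg_EFin; first by near=> n.
have cell a b : a <= b -> fine (mu n `]a, b]%classic) @[n --> \oo] -->
    fine (nu `]a, b]%classic).
  move=> ab; apply: fine_cvg; rewrite fineK ?fin_num_measure//.
  under eq_fun do rewrite measure_ocitv//.
  rewrite measure_ocitv//; apply: cvgeB => //.
  by rewrite fin_num_adde_defl// fin_numN fin_num_measure.
have [M M0 fM] : exists2 M : R, 0 < M & forall x, `|f x| <= M.
  have [M [_ fM]] := bf; exists (`|M| + 1) => [|x]; first by rewrite ltr_pwDr.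
  by apply: fM => //; rewrite ltr_pwDr// ler_norm.
apply/cvgrPdist_lt => eps eps0.
(* The error budget: each of the two integrals is within e + M * e of its step
   sum, and the step sums are within e of each other. *)
have [e e0 epsE] : exists2 e : R, 0 < e & eps = e * 4 + 2 * (M * e).
  have M4 : 0 < 4 + 2 * M by lra.
  exists (eps / (4 + 2 * M)); first by rewrite divr_gt0.
  by field; rewrite gt_eqF.
have [k k0 nuk] := probability_itv_gt nu e0.
have [d d0 fd] := uniformly_continuous_itv (- k%:R) k%:R cf e0.
(* [n] cells of length [h < d] that cover exactly the interval from - k to k. *)
pose n := (Num.truncn (2 * k%:R / d)).+1.
pose h := 2 * k%:R / n%:R : R.
have n0 : 0 < n%:R :> R by rewrite ltr0n.
have h0 : 0 < h by rewrite divr_gt0// mulr_gt0// ltr0n.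
have hd : h < d.
  by rewrite /h ltr_pdivrMr// [d * _]mulrC -ltr_pdivrMr// truncnS_gt.
have kE : k%:R = - k%:R + n%:R * h by rewrite mulrC /h divfK ?gt_eqF//; lra.
pose S (P : probability (measurableTypeR R) R) :=
  \sum_(i < n) f (- k%:R + i.+1%:R * h) *
    fine (P `]- k%:R + i%:R * h, - k%:R + i.+1%:R * h]%classic).
have close (P : probability (measurableTypeR R) R) :
    `|\int[P]_x f x - S P| <= e + M * (1 - fine (P `](- k%:R), k%:R]%classic)).
  have PIC : fine (P (~` `](- k%:R), k%:R]%classic)) =
      1 - fine (P `](- k%:R), k%:R]%classic).
    by rewrite [P (~` _)]probability_setC// fineB// fin_num_measure.
  have -> : \int[P]_x f x = \int[P]_(x in `](- k%:R), k%:R]) f x +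
                           \int[P]_(x in ~` `](- k%:R), k%:R]) f x.
    rewrite -Rintegral_setU//; first by rewrite setUv.
    - exact: measurableC.
    - by rewrite setUv; exact: continuous_bounded_integrable.
    - by apply/disj_setPS; rewrite setICr.
  rewrite addrAC (le_trans (ler_normD _ _))// lerD//.
    have := @Rintegral_step_close _ P f cf bf (- k%:R) h e n h0.
    rewrite -kE -/(S P) => /(_ _) /le_trans; apply.
      by move=> x y xk xy; apply/ltW/fd => //; exact: le_lt_trans hd.
    rewrite ler_piMr ?(ltW e0)// -lee_fin fineK ?fin_num_measure//.
    exact: probability_le1.
  have := @Rintegral_cst_close _ P f cf bf (~` `](- k%:R), k%:R]%classic) 0 M.
  rewrite mul0r subr0 PIC; apply; first exact: measurableC.
  by move=> x _; rewrite subr0.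
have cS : S (mu n) @[n --> \oo] --> S nu.
  apply: (@cvg_big _ _ +%R 0) => [|i _]; first exact: add_continuous.
  apply: cvgMl_tmp.
  by apply: cell; rewrite lerD2l ler_wpM2r ?ler_nat// ltW.
near=> N.
have SN : `|S nu - S (mu N)| < e.
  by near: N; move/cvgrPdist_lt : cS; exact.
have IN : 1 - e < fine (mu N `](- k%:R), k%:R]%classic).
  near: N; apply: (cvgr_gt _ (cell _ _ _)) => //.
  by rewrite ge0_cp.
have IN' : M * (1 - fine (mu N `](- k%:R), k%:R]%classic)) <= M * e.
  by rewrite ler_pM2l//; lra.
have nuk' : M * (1 - fine (nu `](- k%:R), k%:R]%classic)) <= M * e.
  by rewrite ler_pM2l//; lra.
have := le_trans (close nu) (lerD (lexx e) nuk').
have := le_trans (close (mu N)) (lerD (lexx e) IN').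
move: SN; rewrite !ltr_norml !ler_norml => /andP[a1 a2] /andP[b1 b2] /andP[c1 c2].
by rewrite /=; apply/andP; split; lra.
Unshelve. all: by end_near. Qed.

(** * Uniform measures on finite sets *)

Lemma mnormalizeE d (T : measurableType d) (R : realType)
    (mu : {measure set T -> \bar R}) (P : probability T R) (r : R) (U : set T) :
  0 < r -> mu setT = r%:E -> mnormalize mu P U = (r^-1%:E * mu U)%E.
Proof.
by move=> r0 mur; rewrite /mnormalize mur eqe gt_eqF//= muleC.
Qed.

Lemma delta_probability (R : realType) (A : {fset R}) : (0 < #|` A|)%N ->
  exists P : probability (measurableTypeR R) R,
    delta A = P :> (set (measurableTypeR R) -> \bar R).
Proof.
move=> A0.
pose m : {measure set (measurableTypeR R) -> \bar R} :=
  msum (fun k => dirac (nth 0 A k : measurableTypeR R)) #|` A|.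
have mT : m setT = (#|` A|%:R)%:E.
  rewrite /m/= /msum (eq_bigr (fun=> 1%E)) => [|i _]; last exact: diracT.
  by rewrite sumEFin /= sumr_const card_ord.
have mE U : (\sum_(a <- A) dirac (a : measurableTypeR R) U = m U)%E.
  rewrite /m/= /msum.
  by rewrite (big_nth 0) big_mkord.
exists (mnormalize m (dirac (0 : measurableTypeR R))).
apply/funext => U; rewrite /delta mE.
by rewrite [RHS](mnormalizeE _ _ _ mT)// ltr0n.
Qed.

Lemma scale_injective (R : realType) (c : R) :
  c != 0 -> injective (fun b : nat => c * b%:R).
Proof. by move=> c0 a b /(mulfI c0)/eqP; rewrite eqr_nat => /eqP. Qed.

Lemma card_scale_set (R : realType) (c : R) (B : {fset nat}) :
  c != 0 -> #|` scale_set c B| = #|` B|.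
Proof. by move=> /scale_injective ci; rewrite card_imfset. Qed.

Lemma delta_scale_set (R : realType) (c : R) (B : {fset nat}) (U : set R) :
  c != 0 ->
  delta (scale_set c B) U =
  ((\sum_(b <- B) (`[< U (c * b%:R) >])%:R) / (#|` B|%:R))%:E.
Proof.
move=> c0; rewrite /delta card_scale_set// mulrC EFinM; congr (_ * _)%E.
rewrite big_imfset/=; last by move=> x y _ _; exact: scale_injective.
rewrite -sumEFin; apply: eq_bigr => b _.
by rewrite diracE; congr (_%:R%:E); rewrite inE.
Qed.

(** * Weak limits of decreasing distribution functions *)

Section cdf_right_continuity.
Context (R : realType) (P : probability (measurableTypeR R) R).

Let idTR : measurableTypeR R -> R := idfun.

#[local] HB.instance Definition _ :=
  @isMeasurableFun.Build _ _ _ _ idTR (@measurable_id _ _ setT).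

Lemma cdf_at_right (x : R) :
  fine (P `]-oo, y]%classic) @[y --> x^'+] --> fine (P `]-oo, x]%classic).
Proof.
apply: fine_cvg; rewrite fineK ?fin_num_measure//.
have := @cdf_right_continuous _ _ R P idTR x.
by rewrite /cdf /distribution /pushforward preimage_id.
Qed.

End cdf_right_continuity.

Section decreasing_cdf_limit.
Context (R : realType) (mu : nat -> probability (measurableTypeR R) R).
Hypothesis mu_lt0 : forall n, mu n `]-oo, 0%R[%classic = 0%E.
Hypothesis mu_tail : forall e : R, 0 < e ->
  exists C : R, forall n, (mu n `]C, +oo[%classic <= e%:E)%E.
Hypothesis cdf_decr : forall n (x : R),
  (mu n.+1 `]-oo, x]%classic <= mu n `]-oo, x]%classic)%E.

Let F_ n (x : R) := fine (mu n `]-oo, x]%classic).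
Let F (x : R) := inf (range (F_ ^~ x)).

Let F_ge0 n x : 0 <= F_ n x. Proof. exact: fine_ge0. Qed.

Let F_le1 n x : F_ n x <= 1.
Proof. by rewrite -lee_fin fineK ?fin_num_measure ?probability_le1. Qed.

Let F_nd n : nondecreasing_fun (F_ n).
Proof.
move=> x y xy; rewrite fine_le ?fin_num_measure// le_measure ?inE//.
exact: subset_itvl.
Qed.

Let F_lb x : has_lbound (range (F_ ^~ x)).
Proof. by exists 0 => _ [n _ <-]. Qed.

Let F_leF_ n x : F x <= F_ n x.
Proof. by apply: ge_inf => //; exists n. Qed.

Let leF c x : (forall n, c <= F_ n x) -> c <= F x.
Proof.
by move=> cF; apply: lb_le_inf => [|_ [n _ <-]//]; exists (F_ 0 x), 0.
Qed.

Let cvgF x : F_ n x @[n --> \oo] --> F x.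
Proof.
apply: nonincreasing_cvgn => //; apply/nonincreasing_seqP => n.
by rewrite fine_le ?fin_num_measure.
Qed.

Let F_nondecreasing : nondecreasing F.
Proof.
by move=> x y xy; apply: leF => n; rewrite (le_trans (F_leF_ n x))// F_nd.
Qed.

(** An infimum of right-continuous nondecreasing functions is upper
    semicontinuous and nondecreasing, hence right-continuous; suprema lack this
    property, which is why the monotonicity in [n] has to go this way. *)
Let F_right_continuous : right_continuous F.
Proof.
move=> x; apply/cvgrPdist_lt => e e0.
have F_inf : has_inf (range (F_ ^~ x)) by split=> //; exists (F_ 0 x), 0.
have [_ [n _ <-] Fne] := inf_adherent e0 F_inf.
near=> y.
have xy : x < y by near: y; exact: nbhs_right_gt.
rewrite ler0_norm ?subr_le0 ?F_nondecreasing// ?ltW//.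
rewrite opprB ltrBlDl (le_lt_trans (F_leF_ n y))//.
by near: y; apply: cvgr_lt Fne; exact: cdf_at_right.
Unshelve. all: by end_near. Qed.

Let FNy : F @ -oo --> (0 : R).
Proof.
apply/cvgrPdist_lt => e e0; near=> x.
have x0 : x < 0 by near: x; exact: nbhs_ninfty_lt.
suff -> : F x = 0 by rewrite subrr normr0.
apply/eqP; rewrite eq_le leF// andbT (le_trans (F_leF_ 0 x))//.
rewrite -lee_fin fineK ?fin_num_measure// -[leRHS](mu_lt0 0) le_measure ?inE//.
by apply: subset_itvl; rewrite bnd_simp.
Unshelve. all: by end_near. Qed.

Let Fy : F @ +oo --> (1 : R).
Proof.
apply/cvgrPdist_le => e e0.
have [C muC] := mu_tail e0; near=> x.
have Cx : C <= x by near: x; apply: nbhs_pinfty_ge; exact: num_real.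
rewrite ger0_norm ?subr_ge0 ?(le_trans (F_leF_ 0 x))//.
rewrite lerBlDr -lerBlDl; apply: leF => n.
rewrite (le_trans _ (F_nd n Cx))// lerBlDr -lerBlDl.
rewrite -lee_fin EFinB fineK ?fin_num_measure// -probability_setC//.
by rewrite setCitvl.
Unshelve. all: by end_near. Qed.

#[local] HB.instance Definition _ :=
  isCumulative.Build R _ R F F_nondecreasing F_right_continuous.

#[local] HB.instance Definition _ :=
  isCumulativeBounded.Build R 0 1 F FNy Fy.

(** The half-line bound [mu_lt0] and the uniform tail bound [mu_tail] give [F]
    the limits 0 and 1 at the two ends, so that [F] is a distribution
    function. *)
Lemma decreasing_cdf_converges_weakly :
  exists nu : probability (measurableTypeR R) R,
    converges_weakly (fun n => mu n : set (measurableTypeR R) -> \bar R) nu.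
Proof.
pose nu : probability (measurableTypeR R) R := lebesgue_stieltjes_measure F.
exists nu; apply: converges_weakly_cdf => x.
have -> : nu `]-oo, x]%classic = (F x)%:E by exact: cdf_lebesgue_stieltjes_id.
apply/fine_cvgP; split; last exact: cvgF.
by near=> n; rewrite fin_num_measure.
Unshelve. all: by end_near. Qed.

End decreasing_cdf_limit.

(** * Visits to a letter and size of the denominators *)

Section letter_visits.
Local Open Scope nat_scope.
Implicit Types (w N : nat -> nat).

Definition visits w (k n : nat) := \sum_(i < n) (w i == k).

(** Each letter is early, that is visited fewer than [M] times before, at most
    [M] times.  This is what turns a sum along [w] into a sum over letters. *)
Lemma visits_lt_sum w M k n :
  \sum_(i < n) ((w i == k) && (visits w k i < M)) = minn M (visits w k n).
Proof.
elim: n => [|n ih]; first by rewrite /visits !big_ord0 minn0.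
rewrite big_ord_recr/= ih [visits w k n.+1]big_ord_recr/= -/(visits w k n).
by case: (w n == k) => /=; lia.
Qed.

(** Among the [n] factors of the product, [minn M (visits w k n)] are kept equal
    to [N k] and the others are bounded below by 2.  The right-hand power of 2
    avoids a truncated subtraction in the exponent. *)
Lemma prod_visits_ge N w M k n : (forall j, 1 < N j) ->
  N k ^ minn M (visits w k n) * 2 ^ n <=
  (\prod_(i < n) N (w i)) * 2 ^ minn M (visits w k n).
Proof.
move=> N2; elim: n => [|n ih]; first by rewrite /visits !big_ord0 minn0.
rewrite big_ord_recr/= [visits w k n.+1]big_ord_recr/= -/(visits w k n).
set v := visits w k n in ih *.
have [vM|Mv] := ltnP v M; last first.
  rewrite (minn_idPl Mv) in ih; rewrite (minn_idPl (leq_trans Mv (leq_addr _ _))).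
  by rewrite expnS mulnCA [leqRHS]mulnAC [leqRHS]mulnC leq_mul.
rewrite (minn_idPr (ltnW vM)) in ih; have [->|_] := eqVneq (w n) k; last first.
  rewrite addn0 (minn_idPr (ltnW vM)).
  by rewrite expnS mulnCA [leqRHS]mulnAC [leqRHS]mulnC leq_mul.
rewrite addn1 (minn_idPr vM) !expnS.
by rewrite mulnACA [_ * N k]mulnC [leqRHS]mulnACA leq_mul2l ih orbT.
Qed.

Lemma prod_ge_exp2 N w n : (forall j, 1 < N j) ->
  2 ^ n <= \prod_(i < n) N (w i).
Proof.
move=> N2; elim: n => [|n ih]; first by rewrite big_ord0.
by rewrite big_ord_recr/= expnSr leq_mul.
Qed.

(** In each of the three cases excluded by the exceptional event, the digit [b]
    divided by the first [n.+1] factors is at most a constant times [2 ^- n]: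
    if [w n < K] the sum dominates [b] and the denominator is at least [2 ^ n];
    if [w n] has been visited [M] times, the denominator absorbs
    [N (w n) ^ M]; if [b < N (w n)], the last factor absorbs [b]. *)
Lemma digit_bound N w M K n b : (forall j, 1 < N j) -> b <= N (w n) ^ M ->
  ~~ [&& K <= w n, visits w (w n) n < M & N (w n) <= b] ->
  b * 2 ^ n <= (2 ^ M + \sum_(k < K) N k ^ M) * \prod_(i < n.+1) N (w i).
Proof.
move=> N2 bNM; rewrite !negb_and -!ltnNge big_ord_recr/=.
have := prod_ge_exp2 w n N2; have := prod_visits_ge w M (w n) n N2.
set p := \prod_(i < n) _; have := N2 (w n); set Nw := N (w n) in bNM * => Nw1.
move=> pv p2; set S := \sum_(k < K) _; have M2 : 0 < 2 ^ M by rewrite expn_gt0.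
case/or3P => [wK|Mv|bN].
- have NS : Nw ^ M <= S.
    by rewrite /S (bigD1 (Ordinal wK))//= leq_addr.
  apply: leq_mul.
    by rewrite (leq_trans bNM)// (leq_trans NS)// leq_addl.
  by rewrite (leq_trans p2)// leq_pmulr// ltnW.
- rewrite ltnS in Mv; rewrite (minn_idPl Mv) in pv.
  apply: leq_trans (_ : Nw ^ M * 2 ^ n <= _); first by rewrite leq_mul2r bNM orbT.
  rewrite (leq_trans pv)// [leqLHS]mulnC leq_mul ?leq_addr//.
  by rewrite leq_pmulr// ltnW.
- rewrite mulnC (leq_trans (_ : _ <= p * Nw))//.
    by rewrite leq_mul// ltnW.
  by rewrite leq_pmull// addn_gt0 M2.
Qed.
End letter_visits.

(** * Finite convolutions *)

Section finite_convolutions.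
Context (R : realType) (N : nat -> nat) (B : nat -> {fset nat}).
Hypotheses (N_ge2 : forall k, (2 <= N k)%N) (B_0 : forall k, 0%N \in B k).
Implicit Type w : nat -> nat.
Local Notation mu w n := (@finite_convolution R N B w n).

Let card_B_gt0 k : (0 < #|` B k|)%N.
Proof. by rewrite cardfs_gt0; apply/fset0Pn; exists 0%N. Qed.

Let scale w n : R := (\prod_(i < n.+1) (N (w i))%:R)^-1.

Let scale_gt0 w n : 0 < scale w n.
Proof.
by rewrite invr_gt0 prodr_gt0// => i _; rewrite ltr0n (leq_trans _ (N_ge2 _)).
Qed.

Lemma convolution_factor_probability w n :
  exists Q : probability (measurableTypeR R) R,
    @convolution_factor R N B w n = Q.
Proof.
by apply: delta_probability; rewrite card_scale_set// gt_eqF// scale_gt0.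
Qed.

Lemma finite_convolution_probability w n :
  exists P : probability (measurableTypeR R) R, mu w n = P.
Proof.
elim: n => [|n [P muP]]; first exact: convolution_factor_probability.
have [Q facQ] := convolution_factor_probability w n.+1.
by rewrite /= muP facQ; exact: convolution_probability.
Qed.

(** The union bound over all terms.  With [U i] a half-line at the sum of the
    first thresholds and [V i] a half-line at the threshold of index [i], it
    bounds the tail of the sum by the tails of the terms. *)
Lemma finite_convolution_le w n (U V : nat -> set (measurableTypeR R)) :
  (forall i, measurable (U i)) -> (forall i, measurable (V i)) ->
  U 0%N `<=` V 0%N ->
  (forall i x y, U i.+1 (x + y) -> U i x \/ V i.+1 y) ->
  (mu w n (U n) <= \sum_(i < n.+1) @convolution_factor R N B w i (V i))%E.
Proof.
move=> mU mV UV0 UV; elim: n => [|n ih].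
  rewrite big_ord_recr big_ord0/= add0e.
  have [Q ->] := convolution_factor_probability w 0.
  by rewrite le_measure ?inE.
rewrite big_ord_recr/=; apply: le_trans (leeD2r _ ih).
have [P ->] := finite_convolution_probability w n.
have [Q ->] := convolution_factor_probability w n.+1.
by apply: convolution_le => // x y; exact: UV.
Qed.

Lemma convolution_factor_lt0 w n :
  @convolution_factor R N B w n `]-oo, 0%R[%classic = 0%E.
Proof.
rewrite /convolution_factor -/(scale w n) delta_scale_set ?gt_eqF ?scale_gt0//.
rewrite big1 ?mul0r// => b _; rewrite asboolF//= in_itv/= => /lt_geF.
by rewrite mulr_ge0// ltW ?scale_gt0.
Qed.

Lemma finite_convolution_lt0 w n : mu w n `]-oo, 0%R[%classic = 0%E.
Proof.
apply/eqP; rewrite eq_le; apply/andP; split; last first.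
  by have [P ->] := finite_convolution_probability w n.
apply: (le_trans (@finite_convolution_le w n (fun=> `]-oo, 0%R[%classic)
  (fun=> `]-oo, 0%R[%classic) _ _ _ _)) => //.
  move=> _ x y; rewrite /= !in_itv/= => xy.
  by have [x0|x0] := ltP x 0; [left|right; lra].
by rewrite big1// => i _; exact: convolution_factor_lt0.
Qed.

(** Adding a nonnegative term moves mass to the right. *)
Lemma finite_convolution_cdf_decr w n (x : R) :
  (mu w n.+1 `]-oo, x]%classic <= mu w n `]-oo, x]%classic)%E.
Proof.
rewrite /= -[leRHS]adde0 -(convolution_factor_lt0 w n.+1).
have [P ->] := finite_convolution_probability w n.
have [Q ->] := convolution_factor_probability w n.+1.
apply: convolution_le => // u v; rewrite /= !in_itv/= => uvx.
by have [v0|v0] := ltP v 0; [right|left; lra].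
Qed.

End finite_convolutions.

(** * Tails of the terms *)

Lemma card_high_part n (A : {fset nat}) :
  #|` high_part n A| = (\sum_(b <- A) (n <= b))%N.
Proof.
rewrite card_fset_sum1 -[RHS](@big_fset_incl _ _ _ _ (high_part n A)).
- rewrite big_seq [RHS]big_seq; apply: eq_bigr => b.
  by rewrite !inE/= => /andP[+ bA]; rewrite bA/= -leqNgt => ->.
- exact: fsubsetDl.
- by move=> b bA; rewrite !inE/= bA/= andbT negbK ltnNge => /negbTE->.
Qed.

Section tails.
Context (R : realType) (N : nat -> nat) (B : nat -> {fset nat}) (M : nat).
Hypothesis N_ge2 : forall k, (2 <= N k)%N.
Hypothesis B_le : forall k b, b \in B k -> (b <= N k ^ M)%N.
Implicit Type w : nat -> nat.

Definition high_ratio k : R := #|` high_part (N k) (B k)|%:R / #|` B k|%:R.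

Lemma high_ratio_ge0 k : 0 <= high_ratio k.
Proof. by rewrite divr_ge0. Qed.

(** The constant of [digit_bound]. *)
Let D K : R := (2 ^ M + \sum_(k < K) N k ^ M)%:R.

(** The bound for the probability of the exceptional event of index [n]: an
    early visit to a letter [>= K], with a high digit. *)
Definition early_high_ratio K w n : R :=
  if (K <= w n)%N && (visits w (w n) n < M)%N then high_ratio (w n) else 0.

Lemma convolution_factor_tail K w n :
  (@convolution_factor R N B w n `](D K / 2 ^+ n)%R, +oo[%classic <=
   (early_high_ratio K w n)%:E)%E.
Proof.
have p0 : 0 < \prod_(i < n.+1) (N (w i))%:R :> R.
  by rewrite prodr_gt0// => i _; rewrite ltr0n (leq_trans _ (N_ge2 _)).
rewrite /convolution_factor delta_scale_set ?invr_eq0 ?gt_eqF// lee_fin.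
have small b : b \in B (w n) ->
    ~~ [&& K <= w n, visits w (w n) n < M & N (w n) <= b]%N ->
    `[< `]D K / 2 ^+ n, +oo[%classic
          ((\prod_(i < n.+1) (N (w i))%:R)^-1 * b%:R) >] = false.
  move=> bB nb; apply/asboolP; rewrite /= in_itv/= andbT; apply/negP.
  rewrite -leNgt ler_pdivlMr ?exprn_gt0// -mulrA ler_pdivrMl// /D.
  rewrite -natrX -natr_prod -!natrM ler_nat [leqRHS]mulnC.
  exact: (digit_bound N_ge2 (B_le bB) nb).
rewrite /early_high_ratio; case: ifPn => [/andP[Kw vM]|nc]; last first.
  rewrite big_seq big1 ?mul0r// => b bB; rewrite small//.
  by apply: contra nc => /and3P[-> ->].
rewrite ler_wpM2r// card_high_part natr_sum big_seq [leRHS]big_seq.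
apply: ler_sum => b bB; have [Nb|bN] := leqP (N (w n)) b.
  by rewrite lern1 leq_b1.
by rewrite small// Kw vM /= -ltnNge.
Qed.

Lemma geometric_sum_le (c : R) n : 0 <= c ->
  \sum_(i < n) c / 2 ^+ i <= 2 * c.
Proof.
move=> c0; suff -> : \sum_(i < n) c / 2 ^+ i = 2 * c - 2 * c / 2 ^+ n.
  by rewrite gerBl mulr_ge0 ?invr_ge0 ?mulr_ge0.
elim: n => [|n ih]; first by rewrite big_ord0 expr0 divr1 subrr.
rewrite big_ord_recr/= ih exprS invfM; field.
by rewrite expf_neq0.
Qed.

(** The bound [M] on the number of early visits makes the right-hand side
    independent of [w], apart from the cut-off [L], which only has to exceed
    the first [n] letters. *)
Lemma sum_visits_high_ratio K w n :
  exists L, \sum_(i < n) early_high_ratio K w i <=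
            M%:R * \sum_(K <= k < L) high_ratio k.
Proof.
pose L := (\max_(i < n) w i).+1; exists L.
have qE i : (i < n)%N -> early_high_ratio K w i = \sum_(K <= k < L)
    ((w i == k) && (visits w k i < M)%N)%:R * high_ratio k.
  move=> n_i.
  have wL : (w i < L)%N.
    by rewrite ltnS (@leq_bigmax _ (fun i : 'I_n => w i) (Ordinal n_i)).
  rewrite /early_high_ratio; have [Kw|wK] := leqP K (w i); last first.
    rewrite big_nat big1//= => k /andP[Kk _].
    by rewrite (negbTE (_ : w i != k)) ?mul0r// ltn_eqF// (leq_trans wK).
  rewrite (bigD1_seq (w i)) ?mem_index_iota ?Kw ?iota_uniq//= eqxx/=.
  rewrite big1 ?addr0; last by move=> k; rewrite eq_sym => /negbTE->; rewrite mul0r.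
  by case: ifP; rewrite ?mul1r ?mul0r.
rewrite (eq_bigr (fun i : 'I_n => \sum_(K <= k < L)
    ((w i == k) && (visits w k i < M)%N)%:R * high_ratio k)); last first.
  by move=> i _; exact: qE.
rewrite exchange_big mulr_sumr/=; apply: ler_sum => k _.
rewrite -mulr_suml ler_wpM2r ?high_ratio_ge0// -natr_sum ler_nat.
by rewrite visits_lt_sum geq_minl.
Qed.

End tails.

(** The growth condition in multiplicative form.  If the largest digit is 0 its
    logarithm is [-oo] and the claim is trivial; a supremum equal to [-oo] is
    the case where no [B k] contains a positive digit. *)
Lemma digit_le_exp (R : realType) (N : nat -> nat) (B : nat -> {fset nat}) :
  (forall k, (2 <= N k)%N) ->
  (ereal_sup (range (log_ratio R N B)) < +oo)%E ->
  exists M, forall k b, b \in B k -> (b <= N k ^ M)%N.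
Proof.
move=> N2 sup_lty.
have [M logM] : exists M : nat, forall k, (log_ratio R N B k <= M%:R%:E)%E.
  have log_le k : (log_ratio R N B k <= ereal_sup (range (log_ratio R N B)))%E.
    by apply: ereal_sup_ubound; exists k.
  case: (ereal_sup _) sup_lty log_le => [r|//|] _ log_le.
    exists (Num.truncn r).+1 => k; rewrite (le_trans (log_le k))// lee_fin.
    by rewrite ltW// truncnS_gt.
  by exists 0%N => k; rewrite (le_trans (log_le k))// leNye.
exists M => k b bB; rewrite (leq_trans (@leq_bigmax_seq _ _ xpredT id _ bB isT))//.
have lnN0 : 0 < ln (N k)%:R :> R by rewrite ln_gt0// ltr1n.
have N0 : 0 < (N k)%:R :> R by rewrite ltr0n (leq_trans _ (N2 k)).
move: (logM k); rewrite /log_ratio.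
set m := (\max_(b <- B k) b)%N; have [->//|m0] := posnP m.
rewrite (lne_EFin N0) lne_EFin ?ltr0n//.
rewrite inver gt_eqF// -EFinM lee_fin ler_pdivrMr//.
rewrite mulr_natl -lnXn// ler_ln ?posrE ?exprn_gt0// ?ltr0n//.
by rewrite -natrX ler_nat.
Qed.

(** * Uniform tail bound *)

Section uniform_tail.
Context (R : realType) (N : nat -> nat) (B : nat -> {fset nat}) (M : nat).
Hypotheses (N_ge2 : forall k, (2 <= N k)%N) (B_0 : forall k, 0%N \in B k).
Hypothesis B_le : forall k b, b \in B k -> (b <= N k ^ M)%N.
Hypothesis RBC : remainder_bounded R N B.

Lemma high_ratio_tail (e : R) : 0 < e ->
  exists K, forall L, \sum_(K <= k < L) high_ratio R N B k <= e.
Proof.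
move=> e0.
have h0 k : (0 <= (high_ratio R N B k)%:E)%E by rewrite lee_fin high_ratio_ge0.
have := nneseries_tail_cvg RBC (fun k _ => h0 k).
move/fine_cvgP => [fin] /cvgrPdist_lt/(_ _ e0) small.
have [K _ /(_ K (leqnn K))/= [Kfin]] := filterI fin small.
rewrite sub0r normrN => sK; exists K => L.
rewrite -lee_fin -sumEFin.
apply: (@le_trans _ _ (\sum_(K <= k <oo) (high_ratio R N B k)%:E)%E).
  exact: nneseries_lim_ge.
by rewrite -(fineK Kfin) lee_fin (le_trans (ler_norm _))// ltW.
Qed.

(** Taking the thresholds [D / 2 ^ i] for the terms gives the threshold [2 * D]
    for the sum, and [K] is chosen before [w] and [n]. *)
Lemma uniform_tail (e : R) : 0 < e ->
  exists C : R, forall w n,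
    (@finite_convolution R N B w n `]C, +oo[%classic <= e%:E)%E.
Proof.
move=> e0.
have M1 : 0 < M.+1%:R :> R by rewrite ltr0n.
(* Dividing by [M.+1] rather than [M] covers the case [M = 0]. *)
have [K tailK] := high_ratio_tail (divr_gt0 e0 M1).
pose D : R := (2 ^ M + \sum_(k < K) N k ^ M)%:R.
exists (2 * D) => w n.
have [P muP] := finite_convolution_probability R N_ge2 B_0 w n.
pose U i : set (measurableTypeR R) :=
  `](\sum_(j < i.+1) D / 2 ^+ j), +oo[%classic.
pose V i : set (measurableTypeR R) := `](D / 2 ^+ i), +oo[%classic.
apply: (@le_trans _ _ (@finite_convolution R N B w n (U n))).
  rewrite muP; apply: le_measure; rewrite ?inE; [exact: measurable_itv..|].
  move=> x; rewrite /U/= !in_itv/= !andbT; apply: le_lt_trans.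
  exact: geometric_sum_le.
apply: le_trans (@finite_convolution_le R N B N_ge2 B_0 w n U V _ _ _ _) _ => //.
- by move=> i; exact: measurable_itv.
- by move=> i; exact: measurable_itv.
- by rewrite /U /V /= big_ord1.
- move=> i x y; rewrite /U /V /= !in_itv/= !andbT big_ord_recr/=.
  set s := \sum_(_ < _) _ => sxy.
  by have [sx|xs] := ltP s x; [left|right; lra].
have [L qL] := sum_visits_high_ratio R N B M K w n.+1.
apply: (@le_trans _ _ (\sum_(i < n.+1) (early_high_ratio R N B M K w i)%:E)%E).
  by apply: lee_sum => i _; exact: convolution_factor_tail.
rewrite sumEFin lee_fin (le_trans qL)//.
apply: (@le_trans _ _ (M.+1%:R * (e / M.+1%:R))); last first.
  by rewrite mulrC divfK// gt_eqF.
by rewrite ler_pM// ?sumr_ge0// ?ler_nat// => k _; exact: high_ratio_ge0.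
Qed.
End uniform_tail.

(** * Existence of the limits and tightness *)

Section plateau.
Context (R : realType).

(** A continuous function between the indicators of the intervals of radius [r]
    and [r + 1]: it carries a lower bound on the mass of an interval through a
    weak limit, at the cost of enlarging the interval. *)
Definition plateau (r x : R) : R := Num.max 0 (Num.min 1 (r + 1 - `|x|)).

Lemma plateau_continuous r : continuous (plateau r).
Proof.
move=> x.
apply: (@continuous_max _ _ (fun=> 0) (fun x => Num.min 1 (r + 1 - `|x|))).
  exact: cvg_cst.
apply: (@continuous_min _ _ (fun=> 1) (fun x => r + 1 - `|x|)).
  exact: cvg_cst.
by apply: cvgB; [exact: cvg_cst|exact: norm_continuous].
Qed.

Lemma plateau_ge0 r x : 0 <= plateau r x. Proof. by rewrite le_max lexx. Qed.

Lemma plateau_le1 r x : plateau r x <= 1.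
Proof. by rewrite ge_max ler01 ge_min lexx. Qed.

Lemma plateau_bounded r : bounded_fun (plateau r).
Proof.
exists 1; split => // M M1 x _; rewrite /= ger0_norm ?plateau_ge0//.
by rewrite (le_trans (plateau_le1 _ _))// ltW.
Qed.

Let plateau_measurable r :
  measurable_fun [set: measurableTypeR R] (EFin \o plateau r).
Proof.
have cb : continuous (plateau r) by exact: plateau_continuous.
have mb := continuous_measurable_fun cb.
by apply/measurable_EFinP.
Qed.

Lemma measure_le_integral_plateau (P : probability (measurableTypeR R) R)
    (r : R) :
  (P `[(- r)%R, r]%classic <= \int[P]_x (plateau r x)%:E)%E.
Proof.
rewrite -[P _]mul1e -integral_cst//.
rewrite integral_mkcond; apply: ge0_le_integral => //.
- by move=> x _; rewrite /patch; case: ifP.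
- by apply/(measurable_restrictT _ _).1.
- exact: plateau_measurable.
- move=> x _; rewrite /patch; case: ifPn => [|_].
    rewrite inE/= in_itv/= -ler_norml => xr; rewrite lee_fin /plateau.
    by rewrite le_max le_min lexx/=; apply/orP; right; lra.
  by rewrite lee_fin plateau_ge0.
Qed.

Lemma integral_plateau_le_measure (P : probability (measurableTypeR R) R)
    (r : R) :
  (\int[P]_x (plateau r x)%:E <= P `[(- (r + 1))%R, (r + 1)%R]%classic)%E.
Proof.
rewrite -[leRHS]mul1e -integral_cst//.
rewrite [leRHS]integral_mkcond; apply: ge0_le_integral => //.
- by move=> x _; rewrite lee_fin plateau_ge0.
- exact: plateau_measurable.
- by apply/(measurable_restrictT _ _).1.
- move=> x _; rewrite /patch; case: ifPn => [_|].
    by rewrite lee_fin plateau_le1.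
  rewrite notin_setE/= in_itv/= -ler_norml => /negP; rewrite -ltNge => xr.
  by rewrite lee_fin /plateau ge_max lexx ge_min; apply/orP; right; lra.
Qed.

End plateau.

Theorem theorem1p5 (R : realType) (N : nat -> nat) (B : nat -> {fset nat})
    (N_ge2 : forall k : nat, (2 <= N k)%N)
    (B_0 : forall k : nat, 0%N \in B k)
    (card_B : forall k : nat, (#|` B k|%fset <= N k)%N)
    (RBC : remainder_bounded R N B)
    (log_bound : (ereal_sup (range (log_ratio R N B)) < +oo)%E) :
  (forall w : nat -> nat, exists nu : probability (measurableTypeR R) R,
     is_infinite_convolution N B w nu) /\
  tight (fun nu : probability (measurableTypeR R) R =>
     exists w : nat -> nat, is_infinite_convolution N B w nu).
Proof.
have [M B_le] := digit_le_exp N_ge2 log_bound.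
have tail := uniform_tail N_ge2 B_0 B_le RBC.
split=> [w|e e0].
  have [P muP] := choice (finite_convolution_probability R N_ge2 B_0 w).
  have [n|d d0|n x|nu munu] := @decreasing_cdf_converges_weakly R P.
  - by rewrite -muP; exact: finite_convolution_lt0.
  - by have [C muC] := tail d d0; exists C => n; rewrite -muP.
  - by rewrite -!muP; exact: finite_convolution_cdf_decr.
  exists nu; rewrite /is_infinite_convolution.
  by have -> : finite_convolution N B w = (fun n => P n : set _ -> _) by exact/funext.
(* An interval carrying mass at least 1 - e / 2 keeps the infimum strictly above
   1 - e. *)
have e2 : 0 < e / 2 by rewrite divr_gt0.
have [C muC] := tail _ e2.
have [r Cr r0] : exists2 r, C <= r & 0 <= r.
  by exists `|C|; rewrite ?ler_norm.
exists `[- (r + 1), r + 1]%classic; first exact: segment_compact.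
apply: (@lt_le_trans _ _ (1 - e / 2)%:E); first by rewrite lte_fin; lra.
apply: le_ereal_inf_tmp => _ [nu [w munu] <-].
apply: le_trans (integral_plateau_le_measure nu r).
apply: cvge_ge (munu _ (@plateau_continuous R r) (@plateau_bounded R r)).
near=> n.
have [P muP] := finite_convolution_probability R N_ge2 B_0 w n.
rewrite muP; apply: le_trans (measure_le_integral_plateau P r).
have -> : `[- r, r]%classic = ~` (`]-oo, (- r)[ `|` `]r, +oo[) :> set R.
  rewrite setCU setCitvl setCitvr.
  by apply/seteqP; split => x /=; rewrite !in_itv/= ?andbT => /andP.
rewrite probability_setC; last exact: measurableU.
rewrite EFinB leeB//.
rewrite -[leRHS]add0e; apply: le_trans (measureU2 _ _ _) _ => //.
apply: leeD.
  rewrite -(finite_convolution_lt0 R N_ge2 B_0 w n) muP.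
  apply: le_measure; rewrite ?inE; [exact: measurable_itv..|].
  by apply: subset_itvl; rewrite bnd_simp oppr_le0.
apply: le_trans (muC w n); rewrite muP.
apply: le_measure; rewrite ?inE; [exact: measurable_itv..|].
by move=> x /=; rewrite !in_itv/= !andbT; exact: le_lt_trans.
Unshelve. all: by end_near. Qed.
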